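(* Let $\alpha\in(0,1)$, $\gamma_{\min}\in(0,1)$ and let $J\ge1$ be a fixed number of random sample splits. Suppose $H_0: CB=\mathbf 0_{r\times m}$ holds, and suppose that for each split $j=1,\dots,J$ the set $\mathcal M^{(j)}$ of predictors selected in the screening step satisfies $$P(\mathcal M_*\subseteq\mathcal M^{(j)})=1-O\big[\exp\{-c_0n^{1-\iota}/\log n\}\big]$$ for some constants $c_0>0$ and $\iota<1$. Then the adaptive multi-split adjusted $p$-value $p_t$ satisfies $$\limsup_{n\to\infty}P(p_t\le\alpha)\le\alpha .$$
   Context: Setting: $Y=XB+E$, with $Y$ $n\times m$, $X$ $n\times p$, $B=[\mathbf b_1,\dots,\mathbf b_p]^{\intercal}$ $p\times m$, $E$ with independent $\mathcal N(\mathbf 0,\Sigma)$ rows, $p>n$, $m<n$; $C$ is an $r\times p$ matrix. $\mathcal M_*=\{k:\mathbf b_k\neq\mathbf 0\}$. Procedure. For each $j=1,\dots,J$: (1) randomly split the $n$ observations into independent screening data $\{X_S,Y_S\}$ (size $n_S$) and testing data $\{X_T,Y_T\}$ (size $n_T$). (2) On $\{X_S,Y_S\}$, compute the canonical correlation of $Y_S$ with each column of $X_S$ and let $\mathcal M^{(j)}\subseteq\{1,\dots,p\}$ index the $\lfloor\delta p\rfloor$ columns with the largest absolute canonical correlations, where $n_T>\lfloor\delta p\rfloor+m$. (3) On $\{X_T,Y_T\}$, keep only the columns of $X_T$ indexed by $\mathcal M=\mathcal M^{(j)}$ and compute the statistic $T_3$ (below) for testing $C_{\mathcal M}B_{\mathcal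 M}=\mathbf 0$, where $C_{\mathcal M}$ is the submatrix of $C$ with columns in $\mathcal M$ (redundant rows removed so that it has full row rank) and $B_{\mathcal M}$ the submatrix of $B$ with rows in $\mathcal M$; if $\mathcal M\supseteq\mathcal M_*$, this hypothesis is equivalent to $CB=\mathbf 0$. The $p$-value is $p^{(j)}=1-\Phi(T_3)$, with $\Phi$ the standard normal distribution function. Statistic $T_3$, for a regression with $n$ observations, $p$ predictors, $m$ responses and $C$ of rank $r$ (in step (3), with the corresponding values for the reduced testing data): with $S_E=Y^{\intercal}[I-X(X^{\intercal}X)^{-1}X^{\intercal}]Y$, $\hat B=(X^{\intercal}X)^{-1}X^{\intercal}Y$, $S_X=(C\hat B)^{\intercal}[C(X^{\intercal}X)^{-1}C^{\intercal}]^{-1}C\hat B$ and $L_n=\det(S_E)^{n/2}/\det(S_E+S_X)^{n/2}$, put $T_1=(-2\log L_n+\mu_n)/(n\sigma_n)$, where $\sigma_n^2=2\log\frac{(n+r-p-m)(n-p)}{(n-p-m)(n+r-p)}$ and $\mu_n=n(n-m-p-\frac12)\log\frac{(n+r-p-m)(n-p)}{(n-p-m)(n+r-p)}+nr\log\frac{n+r-p-m}{n+r-p}+nm\log\frac{n-p}{n+r-p}$. Put $T_2=[\log\{\theta_{n,1}/(1-\theta_{n,1})\}-\tilde\mu_n]/\tilde\sigma_n$, where $\theta_{n,1}$ is the largest eigenvalue of $(S_E+S_X)^{-1}S_X$, $\tilde\mu_n=2\log\tan\{(\phi+\gamma)/2\}$, $\tilde\sigma_n^3=16(n-p+r-1)^{-2}\{\sin^2(\phi+\gamma)\sin\phi\sin\gamma\}^{-1}$,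 $\sin^2(\gamma/2)=\{\min(m,r)-1/2\}/(n-p+r-1)$, $\sin^2(\phi/2)=\{\max(m,r)-1/2\}/(n-p+r-1)$. Then $T_3=T_1+T_2\,I(T_2\ge F_n)$ with $F_n>0$ a threshold. Standing assumption: the $p$-values are asymptotically valid, i.e. under $H_0$, conditionally on the event $\mathcal M_*\subseteq\mathcal M^{(j)}$, the $j$-th statistic $T_3$ converges in distribution to $\mathcal N(0,1)$ (equivalently, $p^{(j)}$ converges in distribution to the uniform distribution on $[0,1]$). Aggregation: for $\gamma\in(0,1)$ let $Q(\gamma)=\min\{1,q_\gamma(\{p^{(j)}/\gamma: j=1,\dots,J\})\}$, where $q_\gamma$ is the empirical $\gamma$-quantile, i.e. the smallest $x$ such that at least a fraction $\gamma$ of the $J$ values is $\le x$. The adjusted $p$-value is $$p_t=\min\Big\{1,\ (1-\log\gamma_{\min})\inf_{\gamma\in(\gamma_{\min},1)}Q(\gamma)\Big\}.$$ *)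

(* Defs.v *)
From mathcomp Require Import all_boot all_order all_algebra.
From mathcomp Require Import all_classical all_reals all_analysis.

Set Implicit Arguments.
Unset Strict Implicit.
Unset Printing Implicit Defensive.

Import Order.TTheory GRing.Theory Num.Theory.
Import numFieldNormedType.Exports.

Local Open Scope classical_set_scope.
Local Open Scope ring_scope.

Section probability_notions.

Definition borel (T : topologicalType) : set (set T) := <<s [set U | open U] >>.

Definition sigma_gen (T T' : Type) (G : set (set T')) (f : T -> T') :
  set (set T) := preimage_set_system setT f G.

Context d (T : measurableType d) (R : realType) (P : probability T R).

Definition random_element (T' : Type) (G : set (set T')) (f : T -> T') : Prop :=
  sigma_gen G f `<=` measurable.

(* As every [F i] contains [setT], the product rule over the whole index type
   gives the one over every subfamily. *)
Definition mutually_independent (I : finType) (F : I -> set (set T)) : Prop :=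
  forall A : I -> set T, (forall i, F i (A i)) ->
    P (\bigcap_(i in [set: I]) A i) = (\prod_(i : I) P (A i))%E.

(* [normal_prob 0 0] is not the point mass at 0 in the library, so the
   degenerate case is treated apart. *)
Definition centered_normal (v : R) : set R -> \bar R :=
  if v == 0 then \d_(0 : R) else normal_prob 0 (Num.sqrt v).

(* N(0, Sigma), for a possibly singular covariance matrix Sigma: every linear
   functional of Z is univariate normal with the corresponding variance. *)
Definition mvnormal (m : nat) (Sigma : 'M[R]_m) (Z : T -> 'rV[R]_m) : Prop :=
  [/\ Sigma^T = Sigma,
      forall u : 'cV[R]_m, 0 <= (u^T *m Sigma *m u) 0 0
    & forall (u : 'cV[R]_m) (U : set R), measurable U ->
        P ((fun w => (Z w *m u) 0 0) @^-1` U) =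
        centered_normal ((u^T *m Sigma *m u) 0 0) U].

Definition uniform_subset (n k : nat) (S : T -> {set 'I_n}) : Prop :=
  forall A : {set 'I_n},
    P [set w | S w = A] = ((#|A| == k)%:R / 'C(n, k)%:R)%:E.

End probability_notions.

Definition Phi (R : realType) (x : R) : R :=
  fine (normal_prob (0 : R) 1 `]-oo, x]).

(* Conditionally on [A n], [Z n] converges in distribution to N(0,1).  The
   sample space may change with n. *)
Definition cvg_stdnormal_given (R : realType) (d : nat -> measure_display)
    (T : forall n, measurableType (d n)) (P : forall n, probability (T n) R)
    (A : forall n, set (T n)) (Z : forall n, T n -> R) : Prop :=
  (\forall n \near \oo, measurable_fun setT (Z n)) /\
  forall x : R,
    (fun n => fine (P n (A n `&` [set w | Z n w <= x])) / fine (P n (A n)))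
      @ \oo --> Phi x.

Section statistics.
Variable R : realType.

Section correlation.
Variables n m : nat.
Implicit Types (x y : 'cV[R]_n) (Y : 'M[R]_(n, m)).

Definition center x : 'cV[R]_n := x - const_mx ((\sum_i x i 0) / n%:R).

Definition sample_corr x y : R :=
  (\sum_i center x i 0 * center y i 0) /
  Num.sqrt ((\sum_i center x i 0 ^+ 2) * (\sum_i center y i 0 ^+ 2)).

Definition canonical_corr Y x : R :=
  sup [set sample_corr (Y *m a) x | a in [set: 'cV[R]_m]].

End correlation.

(* [M] consists of [k] columns of [X] of largest absolute canonical correlation
   with [Y]; ties are broken arbitrarily. *)
Definition top_canonical (n p m k : nat) (X : 'M[R]_(n, p)) (Y : 'M[R]_(n, m))
    (M : {set 'I_p}) : Prop :=
  #|M| = k /\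
  forall i j, i \in M -> j \notin M ->
    `|canonical_corr Y (col j X)| <= `|canonical_corr Y (col i X)|.

Section T3.
Variables (n p m r : nat).
Variables (X : 'M[R]_(n, p)) (Y : 'M[R]_(n, m)) (C : 'M[R]_(r, p)).

Let nR : R := n%:R.
Let pR : R := p%:R.
Let mR : R := m%:R.
Let rR : R := r%:R.

Definition SE : 'M[R]_m :=
  Y^T *m (1%:M - X *m invmx (X^T *m X) *m X^T) *m Y.

Definition Bhat : 'M[R]_(p, m) := invmx (X^T *m X) *m X^T *m Y.

Definition SX : 'M[R]_m :=
  (C *m Bhat)^T *m invmx (C *m invmx (X^T *m X) *m C^T) *m (C *m Bhat).

Definition LR : R := (\det SE `^ (nR / 2)) / (\det (SE + SX) `^ (nR / 2)).

Definition lratio : R :=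
  ln (((nR + rR - pR - mR) * (nR - pR)) / ((nR - pR - mR) * (nR + rR - pR))).

Definition T1_sigma : R := Num.sqrt (2 * lratio).

Definition T1_mu : R :=
  nR * (nR - mR - pR - 2^-1) * lratio
  + nR * rR * ln ((nR + rR - pR - mR) / (nR + rR - pR))
  + nR * mR * ln ((nR - pR) / (nR + rR - pR)).

Definition T1 : R := (- 2 * ln LR + T1_mu) / (nR * T1_sigma).

Definition theta1 : R := sup [set a | eigenvalue (invmx (SE + SX) *m SX) a].

Definition roydf : R := nR - pR + rR - 1.

(* The angles are the solutions in [0, pi] of
   sin^2 (gamma / 2) = (min(m, r) - 1/2) / (n - p + r - 1) and
   sin^2 (phi / 2) = (max(m, r) - 1/2) / (n - p + r - 1). *)
Definition roy_gamma : R :=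
  2 * asin (Num.sqrt (((minn m r)%:R - 2^-1) / roydf)).

Definition roy_phi : R :=
  2 * asin (Num.sqrt (((maxn m r)%:R - 2^-1) / roydf)).

Definition T2_mu : R := 2 * ln (tan ((roy_phi + roy_gamma) / 2)).

Definition T2_sigma : R :=
  (16 / roydf ^+ 2 *
   (sin (roy_phi + roy_gamma) ^+ 2 * sin roy_phi * sin roy_gamma)^-1) `^ (3^-1).

Definition T2 : R := (ln (theta1 / (1 - theta1)) - T2_mu) / T2_sigma.

Definition T3 (F : R) : R := T1 + (if F <= T2 then T2 else 0).

End T3.

(* [C] restricted to the columns in [M], keeping a maximal linearly
   independent subfamily of its rows. *)
Definition reduced_C (r p : nat) (C : 'M[R]_(r, p)) (M : {set 'I_p}) :=
  let CM := colsub (@enum_val _ (mem M)) C in rowsub (maxrankfun CM) CM.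

Definition rows_in (n q : nat) (A : 'M[R]_(n, q)) (S : {set 'I_n}) :
  'M[R]_(#|S|, q) := rowsub (@enum_val _ (mem S)) A.

(* T3 on the observations outside the screening sample [S], with the
   predictors in [M]; the sizes and the rank are those of the reduced data. *)
Definition test_stat (n p m r : nat) (X : 'M[R]_(n, p)) (Y : 'M[R]_(n, m))
    (C : 'M[R]_(r, p)) (F : R) (S : {set 'I_n}) (M : {set 'I_p}) : R :=
  T3 (colsub (@enum_val _ (mem M)) (rows_in X (~: S))) (rows_in Y (~: S))
     (reduced_C C M) F.

Definition active_set (p m : nat) (B : 'M[R]_(p, m)) : {set 'I_p} :=
  [set k | row k B != 0]%SET.

Section aggregation.
Variables (J : nat) (pv : 'I_J -> R).

Definition emp_quantile (g : R) (v : 'I_J -> R) : R :=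
  inf [set x | g * J%:R <= #|[set j | v j <= x]%SET|%:R].

Definition Qagg (g : R) : R :=
  Num.min 1 (emp_quantile g (fun j => pv j / g)).

Definition adjusted_pvalue (gmin : R) : R :=
  Num.min 1 ((1 - ln gmin) * inf [set Qagg g | g in `]gmin, 1[%classic]).

End aggregation.

End statistics.

Section data.
Context d (T : measurableType d) (R : realType) (P : probability T R).
Variables (n p m J : nat).

Definition data_sigma (X : T -> 'M[R]_(n, p)) (E : T -> 'M[R]_(n, m))
    (S : 'I_J -> T -> {set 'I_n}) (i : 'I_n + 'I_n + 'I_J) : set (set T) :=
  match i with
  | inl (inl k) => sigma_gen (@borel 'rV[R]_p) (fun w => row k (X w))
  | inl (inr k) => sigma_gen (@borel 'rV[R]_m) (fun w => row k (E w))
  | inr j => sigma_gen setT (S j)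
  end.

(* Normal regression data together with J random splits.  The design is allowed
   to be random, with independent rows that are independent of the errors; a
   fixed design is the case of a constant [X].  The testing sample of the
   j-th split is the complement of the screening sample [S j]. *)
Definition split_data (nS : nat) (Sigma : 'M[R]_m) (X : T -> 'M[R]_(n, p))
    (E : T -> 'M[R]_(n, m)) (S : 'I_J -> T -> {set 'I_n}) : Prop :=
  [/\ forall i, data_sigma X E S i `<=` measurable,
      mutually_independent P (data_sigma X E S),
      forall k, mvnormal P Sigma (fun w => row k (E w))
    & forall j, uniform_subset P nS (S j)].

End data.

(* Main.v *)
(* Put a = alpha / (1 - ln gmin).  Since there are only J p-values, p_t <= alpha
   means that, for some integer k with gmin J < k <= J, at least k of them are
   at most a k / J.  Weighting the indicators of {p_j <= a k / J} by
   1/k - 1/(k+1) for k < J, and by 1/J for k = J, gives a sum that is at least 1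
   on this event, so that by Markov's inequality its probability is at most
   the weighted sum of the P(p_j <= a k / J).  Each of these has limsup at most
   a k / J, because Phi is continuous and the screening event has probability
   tending to 1, and with k0 the least admissible k the weighted sum of the
   a k / J over j and k is a (1 + 1/(k0+1) + ... + 1/J) <= a (1 + ln (J/k0))
   <= a (1 - ln gmin) = alpha. *)
Require Import Defs.
From HB Require Import structures.
From mathcomp Require Import all_boot all_order all_algebra.
From mathcomp Require Import all_classical all_reals all_analysis measurable_realfun.
From mathcomp Require Import ring lra.
Set Implicit Arguments.
Unset Strict Implicit.
Unset Printing Implicit Defensive.
Import Order.TTheory GRing.Theory Num.Theory.
Import numFieldNormedType.Exports.
Local Open Scope classical_set_scope.
Local Open Scope ring_scope.

(** * The standard normal distribution function: monotonicity, continuity, range *)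

Lemma normal_prob_itvoc (R : realType) (x y : R) : x <= y ->
  (normal_prob 0 1 `]x, y] <= (normal_peak 1 * (y - x))%:E)%E.
Proof.
move=> xy; apply: (@le_trans _ _
    (\int[lebesgue_measure]_(z in `]x, y]) (normal_peak (1 : R))%:E)%E).
  apply: ge0_le_integral => //=.
  - by move=> z _; rewrite lee_fin normal_pdf_ge0.
  - by apply/measurable_EFinP/measurable_funTS; exact: measurable_normal_pdf.
  - by move=> z _; rewrite lee_fin normal_pdf_ub// oner_neq0.
rewrite integral_cst//= lebesgue_measure_itv/= lte_fin EFinM.
by case: ltgtP xy => // -> _; rewrite subrr.
Qed.

Lemma PhiD (R : realType) (x y : R) : x <= y ->
  Phi y = Phi x + fine (normal_prob 0 1 `]x, y]).
Proof.
move=> xy; rewrite /Phi -fineD ?fin_num_measure//.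
rewrite -measureU//; last first.
  apply/seteqP; split=> z //=; rewrite !in_itv/= => -[zx /andP[]].
  by rewrite ltNge zx.
congr (fine (normal_prob _ _ _)); apply/seteqP; split=> z /=; rewrite !in_itv/=.
  by move=> zy; rewrite zy andbT; case: (leP z x); [left|right].
by case=> [zx|/andP[]//]; exact: le_trans zx xy.
Qed.

Lemma Phi_ge0 (R : realType) (x : R) : 0 <= Phi x.
Proof. by rewrite fine_ge0. Qed.

Lemma Phi_le1 (R : realType) (x : R) : Phi x <= 1.
Proof.
by rewrite -lee_fin fineK ?fin_num_measure// probability_le1.
Qed.

Lemma Phi_nondecreasing (R : realType) : {homo @Phi R : x y / x <= y}.
Proof. by move=> x y xy; rewrite (PhiD xy) lerDl fine_ge0. Qed.

(** The density is bounded by its peak, so [Phi] is Lipschitz with constant [normal_peak 1]. *)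
Lemma Phi_continuous (R : realType) : continuous (@Phi R).
Proof.
have lip (x y : R) : x <= y -> Phi y - Phi x <= normal_peak 1 * (y - x).
  move=> xy; rewrite (PhiD xy) addrAC subrr add0r -lee_fin.
  by rewrite fineK ?fin_num_measure// normal_prob_itvoc.
have lipN (x y : R) : `|Phi x - Phi y| <= normal_peak 1 * `|x - y|.
  wlog xy : x y / x <= y => [h|].
    by case/orP: (le_total x y) => /h//; rewrite distrC (distrC y).
  rewrite distrC (distrC x) ger0_norm ?subr_ge0 ?Phi_nondecreasing//.
  by rewrite ger0_norm ?subr_ge0// lip.
have k0 : 0 < normal_peak (1 : R) by rewrite normal_peak_gt0// oner_neq0.
move=> x; apply/cvgrPdist_lt => e e0; near=> y.
rewrite (le_lt_trans (lipN _ _))// mulrC -ltr_pdivlMr//.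
near: y; apply: cvgr_dist_lt => //; exact: divr_gt0.
Unshelve. all: by end_near. Qed.

Section Phi_limits.
Variable R : realType.

(** The identity, seen as a random variable under the normal law, has [Phi] as its distribution
    function; this gives the limits of [Phi] at both infinities. *)
Let idR : measurableTypeR R -> R := idfun.

#[local] HB.instance Definition _ :=
  @isMeasurableFun.Build _ _ _ _ idR (@measurable_id _ _ setT).

(** Intermediate value theorem between points where [Phi] is below and above [v], which exist by the
    limits 0 and 1. *)
Lemma Phi_attains (v : R) : 0 < v < 1 -> exists x, Phi x = v.
Proof.
move=> /andP[v0 v1].
pose X : {RV (normal_prob 0 1) >-> R} := idR.
have /fine_cvg cvg0 := @cvg_cdfNy0 _ _ _ _ X.
have /fine_cvg cvg1 := @cvg_cdfy1 _ _ _ _ X.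
have [a av] : exists a : R, Phi a < v.
  by have /cvgr_lt/(_ _ v0)/filter_ex[a av] := cvg0; exists a.
have [b bv] : exists b : R, v < Phi b.
  by have /cvgr_gt/(_ _ v1)/filter_ex[b bv] := cvg1; exists b.
have ab : a <= b.
  by rewrite leNgt; apply/negP => /ltW/Phi_nondecreasing; rewrite leNgt (lt_trans av bv).
have [|c _ cv] := @IVT R (@Phi R) a b v ab (continuous_subspaceT (@Phi_continuous R)).
  by rewrite ge_min le_max (ltW av) (ltW bv) orbT.
by exists c.
Qed.

End Phi_limits.

(** * The sure screening rate tends to 0 *)

Lemma powR_div_ln_ge (R : realType) (b : R) (n : nat) : 0 < b -> (1 < n)%N ->
  b / 2 * n%:R `^ (b / 2) <= n%:R `^ b / ln n%:R.
Proof.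
move=> b0 n1; have n0 : 0 < n%:R :> R by rewrite ltr0n ltnW.
have lnn : 0 < ln (n%:R : R) by rewrite ln_gt0// ltr1n.
rewrite ler_pdivlMr// [in leRHS](splitr b) powRD ?lt0r_neq0 ?implybT//.
rewrite mulrAC ler_wpM2r ?powR_ge0//.
(* This is [ln x < x] at [x = n^(b/2)]. *)
by rewrite -ln_powR ltW// ln_sublinear// powR_gt0.
Qed.

Lemma cvg_expRN_powR_div_ln (R : realType) (c b : R) : 0 < c -> 0 < b ->
  expR (- (c * n%:R `^ b / ln n%:R)) @[n --> \oo] --> (0 : R).
Proof.
move=> c0 b0; apply/cvgr0Pnorm_le => e e0.
(* Chosen so that [n^(b/2) >= K] forces the exponent to be at least [1/e]; then
   [exp(-y) <= 1/(1+y) <= e]. *)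
pose K := (c * (b / 2))^-1 * e^-1.
have K0 : 0 < K by rewrite mulr_gt0 ?invr_gt0// !mulr_gt0// invr_gt0.
near=> n.
have n1 : (1 < n)%N by near: n; exists 2%N.
have n0 : 0 < n%:R :> R by rewrite ltr0n ltnW.
have Kn : K <= n%:R `^ (b / 2).
  have -> : K = (K `^ (2 / b)) `^ (b / 2).
    by rewrite -powRrM mulrA divfK ?lt0r_neq0// divff// powRr1// ltW.
  rewrite ge0_ler_powR ?nnegrE ?powR_ge0 ?ler0n// ?divr_ge0 ?(ltW b0)//.
  by near: n; exact: nbhs_infty_ger.
rewrite ger0_norm ?expR_ge0// expRN -[leRHS]invrK lef_pV2 ?posrE ?expR_gt0 ?invr_gt0//.
apply: le_trans (expR_ge1Dx _); rewrite -lerBlDl (@le_trans _ _ e^-1) ?lerBlDr ?lerDl//.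
have -> : e^-1 = c * (b / 2) * K by rewrite /K mulVKf// lt0r_neq0// mulr_gt0// divr_gt0.
rewrite -!mulrA ler_pM2l// (le_trans _ (powR_div_ln_ge b0 n1))// mulrA.
by rewrite ler_pM2l// divr_gt0.
Unshelve. all: by end_near. Qed.

Lemma sure_screening_cvg (R : realType) (u : nat -> R) (c iota : R) :
  0 < c -> iota < 1 ->
  (fun n => 1 - u n : R^o) =O_\oo
    (fun n : nat => expR (- (c * n%:R `^ (1 - iota) / ln n%:R)) : R^o) ->
  u n @[n --> \oo] --> (1 : R).
Proof.
move=> c0 i1 /eqO_exP[k k0 /= uO].
have e0 : k * expR (- (c * n%:R `^ (1 - iota) / ln n%:R)) @[n --> \oo] --> (0 : R).
  rewrite -(mulr0 k); apply: cvgM; first exact: cvg_cst.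
  by apply: cvg_expRN_powR_div_ln; rewrite ?subr_gt0.
apply/cvgrPdist_le => e e_gt0; near=> n.
have /le_trans : `|1 - u n| <= k * `|expR (- (c * n%:R `^ (1 - iota) / ln n%:R))|.
  by near: n.
apply; rewrite (ger0_norm (expR_ge0 _)).
by near: n; exact: (cvgr_le _ e0).
Unshelve. all: by end_near. Qed.

(** * Measurability and asymptotic level of a single p-value *)

Lemma measurable_le_cst d (T : measurableType d) (R : realType) (f : T -> R)
    (c : R) : measurable_fun setT f -> measurable [set w | f w <= c].
Proof.
move=> /(_ measurableT _ (measurable_itv `]-oo, c])); rewrite setTI.
by congr (measurable _); apply/seteqP; split=> w /=; rewrite in_itv.
Qed.

Lemma measurable_pvalue d (T : measurableType d) (R : realType) (f : T -> R) :
  measurable_fun setT f -> measurable_fun setT (fun w => 1 - Phi (f w)).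
Proof.
move=> mf; apply: measurable_funB => //; apply: measurableT_comp mf.
exact: nondecreasing_measurable (@Phi_nondecreasing R).
Qed.

(** If [1 - Phi z > t], then [Z <= z] rules out a p-value at most [t]. The rejection event thus lies
    in the complement of [A] intersected with [Z <= z], whose probability tends to [1 - Phi z]. This
    turns conditional validity into an unconditional bound. *)
Lemma pvalue_near_le (R : realType) (d : nat -> measure_display)
    (T : forall n, measurableType (d n)) (P : forall n, probability (T n) R)
    (A : forall n, set (T n)) (Z : forall n, T n -> R) (t e : R) :
  (\forall n \near \oo, measurable (A n)) ->
  cvg_stdnormal_given P A Z ->
  fine (P n (A n)) @[n --> \oo] --> (1 : R) ->
  0 < t < 1 -> 0 < e ->
  \forall n \near \oo, fine (P n [set w | 1 - Phi (Z n w) <= t]) <= t + e.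
Proof.
move=> mA [mZ cvgZ] cvgA /andP[t0 t1] e0.
have [z Phiz] : exists z : R, t < 1 - Phi z <= t + e / 2.
  (* The second argument of the minimum keeps the target value positive. *)
  have [z Phiz] : exists z : R, Phi z = 1 - t - Num.min (e / 2) ((1 - t) / 2).
    apply: Phi_attains.
    have: 0 < Num.min (e / 2) ((1 - t) / 2) by rewrite lt_min; apply/andP; split; lra.
    have: Num.min (e / 2) ((1 - t) / 2) <= (1 - t) / 2 by rewrite ge_min lexx orbT.
    by lra.
  exists z; rewrite Phiz.
  have: 0 < Num.min (e / 2) ((1 - t) / 2) by rewrite lt_min; apply/andP; split; lra.
  have: Num.min (e / 2) ((1 - t) / 2) <= e / 2 by rewrite ge_min lexx.
  by lra.
(* The joint probability is the conditional one times [P(A)], as soon as [P(A)] is positive. *)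
have cvgAZ : fine (P n (A n `&` [set w | Z n w <= z])) @[n --> \oo] --> Phi z.
  rewrite -[Phi z]mulr1; apply: cvg_trans (cvgM (cvgZ z) cvgA).
  apply: near_eq_cvg; near=> n; rewrite /= divfK//.
  by rewrite lt0r_neq0//; near: n; exact: (cvgr_gt _ cvgA _ ltr01).
near=> n.
have mAn : measurable (A n) by near: n.
have mZn : measurable_fun setT (Z n) by near: n.
have mZle : measurable [set w | Z n w <= z].
  exact: measurable_le_cst.
have mAZ : measurable (A n `&` [set w | Z n w <= z]) by exact: measurableI.
have mp : measurable [set w | 1 - Phi (Z n w) <= t].
  by apply: measurable_le_cst; exact: measurable_pvalue.
have : (P n [set w | 1 - Phi (Z n w) <= t]%R <=
        P n (~` (A n `&` [set w | Z n w <= z]%R)))%E.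
  apply: le_measure; rewrite ?inE//; first exact: measurableC.
  move=> w /= wt [_ wz]; have := Phi_nondecreasing wz; move: Phiz wt; lra.
rewrite probability_setC// -lee_fin fineK ?fin_num_measure// => /le_trans; apply.
rewrite -[P n _]fineK ?fin_num_measure// -EFinB lee_fin.
have : Phi z - e / 2 <= fine (P n (A n `&` [set w | Z n w <= z])).
  by near: n; apply: (cvgr_ge _ cvgAZ); lra.
by move: Phiz; lra.
Unshelve. all: by end_near. Qed.

(** * The event [p_t <= alpha] as a counting condition *)

Section multi_split_pvalue.
Variables (R : realType) (J : nat) (pv : 'I_J -> R).
Hypothesis pv01 : forall j, 0 <= pv j <= 1.

Lemma emp_quantile_set_ge0 (g x : R) : (0 < J)%N -> 0 < g ->
  g * J%:R <= #|[set j | pv j / g <= x]%SET|%:R -> 0 <= x.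
Proof.
move=> J0 g0 gN; have : 0 < #|[set j | pv j / g <= x]%SET|%:R :> R.
  by rewrite (lt_le_trans _ gN)// mulr_gt0// ltr0n.
rewrite ltr0n card_gt0 => /set0Pn[j]; rewrite inE; apply: le_trans.
by have /andP[p0 _] := pv01 j; rewrite divr_ge0// ltW.
Qed.

(** Together with the lower bound 0, this makes the [inf] in [emp_quantile] a genuine infimum rather
    than a default value. The witness [1/g] works since all p-values are at most 1. *)
Lemma emp_quantile_set_nonempty (g : R) : 0 < g <= 1 ->
  [set x | g * J%:R <= #|[set j | pv j / g <= x]%SET|%:R] !=set0.
Proof.
move=> /andP[g0 g1]; exists g^-1 => /=.
have -> : [set j | pv j / g <= g^-1]%SET = [set: 'I_J]%SET.
  apply/setP => j; rewrite !inE ler_piMl ?invr_ge0 ?(ltW g0)//.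
  by have /andP[] := pv01 j.
by rewrite cardsT card_ord ler_piMl.
Qed.

Lemma Qagg_ge0 (g : R) : (0 < J)%N -> 0 < g <= 1 -> 0 <= Qagg pv g.
Proof.
move=> J0 g01; rewrite /Qagg le_min ler01/= lb_le_inf//.
  exact: emp_quantile_set_nonempty.
by move=> x /=; apply: emp_quantile_set_ge0 => //; case/andP: g01.
Qed.

Lemma Qagg_le (g x : R) : (0 < J)%N -> 0 < g <= 1 ->
  g * J%:R <= #|[set j | pv j / g <= x]%SET|%:R -> Qagg pv g <= x.
Proof.
move=> J0 /andP[g0 _] gN; rewrite /Qagg ge_min; apply/orP; right.
by apply: ge_inf => //; exists 0 => y /=; exact: emp_quantile_set_ge0.
Qed.

(** Take [y < x] in the quantile set and let [k] count the p-values at most [y g]. Since [g <= k/J],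
    these are below [x k/J]. *)
Lemma Qagg_lt (g x : R) : (0 < J)%N -> 0 < g <= 1 -> x <= 1 -> Qagg pv g < x ->
  exists k, [/\ (k <= J)%N, g * J%:R <= k%:R &
                (k <= #|[set j | (pv j < x * (k%:R / J%:R))%R]%SET|)%N].
Proof.
move=> J0 g01 x1; have /andP[g0 _] := g01.
rewrite /Qagg gt_min ltNge x1/= => /inf_lt[|y /= gN yx].
  exact: emp_quantile_set_nonempty.
have y0 := emp_quantile_set_ge0 J0 g0 gN.
exists #|[set j | pv j / g <= y]%SET|; split => //.
  by rewrite -[leqRHS]card_ord max_card.
apply: subset_leq_card; apply/fintype.subsetP => j; rewrite !inE ler_pdivrMr// => pvy.
rewrite (le_lt_trans pvy)// (@lt_le_trans _ _ (x * g)) ?ltr_pM2r//.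
by rewrite ler_pM2l ?(le_lt_trans y0)// ler_pdivlMr ?ltr0n.
Qed.

(** The infimum need not be attained, so the forward direction passes through [a + e]. Conversely,
    [k] p-values at most [a k/J] bound [Qagg] at [k/J] by [a]. *)
Lemma inf_QaggP (g a : R) : (0 < J)%N -> 0 < g < 1 -> 0 < a < 1 ->
  inf [set Qagg pv g' | g' in `]g, 1[%classic] <= a <->
  exists k, [/\ (k <= J)%N, g * J%:R < k%:R &
                (k <= #|[set j | (pv j <= a * (k%:R / J%:R))%R]%SET|)%N].
Proof.
move=> J0 /andP[g0 g1] /andP[a0 a1].
have J0R : 0 < J%:R :> R by rewrite ltr0n.
have Qlb : has_lbound [set Qagg pv g' | g' in `]g, 1[%classic].
  exists 0 => _ [h + <-]; rewrite /= in_itv/= => /andP[gh h1].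
  by apply: Qagg_ge0 => //; rewrite (lt_trans g0)// ltW.
split=> [infa|[k [kJ gk kN]]].
  (* As there are finitely many thresholds, some e > 0 adds no p-value below
     them. *)
  have [e [e0 e1 eP]] : exists e, [/\ 0 < e, a + e <= 1 & forall (jk : 'I_J * 'I_J.+1),
      a * (jk.2%:R / J%:R) < pv jk.1 -> (a + e) * (jk.2%:R / J%:R) <= pv jk.1].
    have eP : \forall e \near (0 : R)^'+, forall (jk : 'I_J * 'I_J.+1),
        a * (jk.2%:R / J%:R) < pv jk.1 -> (a + e) * (jk.2%:R / J%:R) <= pv jk.1.
      apply: filter_forall => -[j k] /=.
      have [apv|pva] := ltP (a * (k%:R / J%:R)) (pv j); last by near=> e.
      near=> e => _.
      have kJ01 : k%:R / J%:R <= 1 :> R.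
        by rewrite ler_pdivrMr// mul1r ler_nat -ltnS.
      have e0 : 0 <= e by near: e; exact: nbhs_right_ge.
      rewrite mulrDl -lerBrDl (le_trans (ler_piMr e0 kJ01))//.
      by near: e; apply: nbhs_right_le; rewrite subr_gt0.
    near (0 : R)^'+ => e; exists e; split.
    - by near: e; exact: nbhs_right_gt.
    - by rewrite -lerBrDl; near: e; apply: nbhs_right_le; rewrite subr_gt0.
    - by near: e.
  have ae : a < a + e by rewrite ltrDl.
  have [|_ [h + <-] Qh] := inf_lt _ (le_lt_trans infa ae).
    exists (Qagg pv ((g + 1) / 2)), ((g + 1) / 2) => //=.
    by rewrite in_itv/=; apply/andP; split; lra.
  rewrite /= in_itv/= => /andP[gh h1].
  have [|k [kJ hk kN]] := Qagg_lt J0 _ e1 Qh.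
    by rewrite (lt_trans g0 gh) ltW.
  exists k; split => //; first by rewrite (lt_le_trans _ hk)// ltr_pM2r.
  apply: leq_trans kN _; apply: subset_leq_card; apply/fintype.subsetP => j.
  rewrite !inE => pvj; rewrite leNgt; apply/negP => apv.
  have kJ' : (k < J.+1)%N by [].
  by have := eP (j, Ordinal kJ') apv; rewrite /= leNgt pvj.
have infQ h : g < h < 1 -> inf [set Qagg pv g' | g' in `]g, 1[%classic] <= Qagg pv h.
  by move=> gh; apply: ge_inf => //; exists h => //=; rewrite in_itv.
(* For [k = J] the level [k/J = 1] is outside the open interval and has to be approached from
   below. *)
move: kJ; rewrite leq_eqVlt => /predU1P[kE|kJ].
  rewrite leNgt; apply/negP; set I := inf _ => aI.
  (* Such an [h] gives [a/h < I], against [I <= Qagg pv h <= a/h]. *)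
  have [h [gh h1 aIh]] : exists h, [/\ g < h, h < 1 & a / I < h].
    near (1 : R)^'- => h; exists h; split; near: h.
    - exact: nbhs_left_gt.
    - exact: nbhs_left_lt.
    - by apply: nbhs_left_gt; rewrite ltr_pdivrMr ?mul1r// (lt_trans a0).
  have h0 : 0 < h := lt_trans g0 gh.
  have : I <= a / h.
    apply: (@le_trans _ _ (Qagg pv h)); first by apply: infQ; rewrite gh.
    apply: Qagg_le => //; first by rewrite h0 ltW.
    rewrite (@le_trans _ _ J%:R)//; first by rewrite ler_piMl// ltW.
    rewrite ler_nat -{1}kE (leq_trans kN)//; apply: subset_leq_card.
    apply/fintype.subsetP => j; rewrite !inE kE divff ?lt0r_neq0// mulr1 => pva.
    by rewrite ler_pM2r// invr_gt0.
  apply/negP; rewrite -ltNge ltr_pdivrMr// mulrC -ltr_pdivrMr//.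
  exact: lt_trans a0 aI.
have k01 : g < (k%:R / J%:R : R) < 1.
  apply/andP; split; first by rewrite ltr_pdivlMr.
  by rewrite ltr_pdivrMr// mul1r ltr_nat.
have k0 : 0 < k%:R / J%:R :> R by case/andP: k01 => /(lt_trans g0).
apply: (le_trans (infQ _ k01)); apply: Qagg_le => //.
  by rewrite k0; case/andP: k01 => _ /ltW.
rewrite divfK ?lt0r_neq0// ler_nat (leq_trans kN)//.
by apply: subset_leq_card; apply/fintype.subsetP => j; rewrite !inE ler_pdivrMr.
Unshelve. all: by end_near. Qed.

Lemma adjusted_pvalue_leP (g alpha : R) :
  (0 < J)%N -> 0 < g < 1 -> 0 < alpha < 1 ->
  adjusted_pvalue pv g <= alpha <->
  exists k, [/\ (k <= J)%N, g * J%:R < k%:R &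
    (k <= #|[set j | (pv j <= alpha / (1 - ln g) * (k%:R / J%:R))%R]%SET|)%N].
Proof.
move=> J0 g01 /andP[a0 a1]; have /andP[g0 g1] := g01.
have lng : ln g < 0 by rewrite ln_lt0// g0.
have L1 : 1 < 1 - ln g by rewrite ltrDl oppr_gt0.
have L0 : 0 < 1 - ln g := lt_trans ltr01 L1.
rewrite /adjusted_pvalue ge_min leNgt a1/= mulrC -ler_pdivlMr//.
apply: inf_QaggP => //; rewrite divr_gt0//= ltr_pdivrMr// mul1r.
exact: lt_trans a1 L1.
Qed.

End multi_split_pvalue.

(** * The weights and their harmonic sum *)

Definition layer_weight {R : realType} (J k : nat) : R :=
  if (k < J)%N then (k%:R * k.+1%:R)^-1 else k%:R^-1.

Lemma layer_weight_ge0 (R : realType) (J k : nat) : 0 <= layer_weight J k :> R.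
Proof. by rewrite /layer_weight; case: ifP => _; rewrite invr_ge0 ?mulr_ge0. Qed.

Lemma layer_weight_lt (R : realType) (J k : nat) : (0 < k < J)%N ->
  layer_weight J k = k%:R^-1 - k.+1%:R^-1 :> R.
Proof.
move=> /andP[k0 kJ]; rewrite /layer_weight kJ -natr1.
have : k%:R != 0 :> R by rewrite pnatr_eq0 -lt0n.
have : k%:R + 1 != 0 :> R by rewrite natr1 pnatr_eq0.
by move=> ? ?; field; apply/andP.
Qed.

(** The differences telescope, and the last weight [1/J] cancels the remainder. *)
Lemma sum_layer_weight (R : realType) (J k0 : nat) : (0 < k0 <= J)%N ->
  \sum_(k0 <= k < J.+1) layer_weight J k = k0%:R^-1 :> R.
Proof.
move=> /andP[k00 k0J]; rewrite big_nat_recr//= {2}/layer_weight ltnn.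
transitivity (\sum_(k0 <= k < J) (- (k.+1)%:R^-1 - - k%:R^-1) + J%:R^-1 : R).
  congr (_ + _); apply: eq_big_nat => k /andP[k0k kJ].
  by rewrite layer_weight_lt ?(leq_trans k00)// opprK addrC.
by rewrite (telescope_sumr (fun k => - k%:R^-1 : R))// opprK; ring.
Qed.

Lemma sum_layer_weight_mul (R : realType) (J k0 : nat) : (0 < k0 <= J)%N ->
  \sum_(k0 <= k < J.+1) layer_weight J k * k%:R <= 1 + ln (J%:R / k0%:R) :> R.
Proof.
move=> /andP[k00 k0J]; rewrite big_nat_recr//= {2}/layer_weight ltnn.
have J0 : (0 < J)%N := leq_trans k00 k0J.
rewrite mulVf ?pnatr_eq0 -?lt0n// addrC lerD2l.
have -> : ln (J%:R / k0%:R) = \sum_(k0 <= k < J) (ln k.+1%:R - ln k%:R) :> R.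
  by rewrite (telescope_sumr (fun k => ln k%:R : R))// ln_div// posrE ltr0n.
apply: ler_sum_nat => k /andP[k0k kJ].
have k0' : (0 < k)%N := leq_trans k00 k0k.
have k0R : 0 < k%:R :> R by rewrite ltr0n.
have k1R : 0 < k.+1%:R :> R by rewrite ltr0n.
have -> : layer_weight J k * k%:R = 1 - k%:R / k.+1%:R :> R.
  rewrite layer_weight_lt ?k0'// mulrBl mulVf ?lt0r_neq0//.
  by rewrite mulrC.
(* The claim [1/(k+1) <= ln((k+1)/k)] is, after negation, [ln(1+x) <= x] at [x = k/(k+1) - 1]. *)
rewrite -lerN2 !opprB -ln_div ?posrE//.
have := @le_ln1Dx R (k%:R / k.+1%:R - 1); rewrite addrCA subrr addr0; apply.
by rewrite ltrDr divr_gt0.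
Qed.

(** For [k >= k1] monotonicity gives [N k >= k1], and the weights from [k1] on sum to [1/k1]. *)
Lemma layer_weight_count (R : realType) (J k0 k1 : nat) (N : nat -> nat) :
  (0 < k0 <= k1)%N -> (k1 <= J)%N -> {homo N : k l / (k <= l)%N} ->
  (k1 <= N k1)%N ->
  1 <= \sum_(k0 <= k < J.+1) layer_weight J k * (N k)%:R :> R.
Proof.
move=> /andP[k00 k01] k1J Nhomo k1N.
have k10 : (0 < k1)%N := leq_trans k00 k01.
rewrite (big_cat_nat k01 (leqW k1J))/= -[leLHS]add0r lerD//.
  by apply: sumr_ge0 => k _; rewrite mulr_ge0// layer_weight_ge0.
apply: (@le_trans _ _ (\sum_(k1 <= k < J.+1) layer_weight J k * k1%:R)).
  by rewrite -mulr_suml sum_layer_weight ?k10// mulVf// pnatr_eq0 -lt0n.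
apply: ler_sum_nat => k /andP[k1k _].
by rewrite ler_wpM2l ?layer_weight_ge0// ler_nat (leq_trans k1N)// Nhomo.
Qed.

(** * The weighted Markov bound for the counting event *)

Lemma weighted_markov d (T : measurableType d) (R : realType)
    (P : probability T R) (I : Type) (s : seq I) (c : I -> R) (A : I -> set T)
    (B : set T) :
  measurable B -> (forall i, measurable (A i)) -> (forall i, 0 <= c i) ->
  (forall w, B w -> 1 <= \sum_(i <- s) c i * \1_(A i) w) ->
  fine (P B) <= \sum_(i <- s) c i * fine (P (A i)).
Proof.
move=> mB mA c0 cB.
have mc i : measurable_fun setT (fun w => ((c i)%:E * (\1_(A i) w)%:E)%E).
  by apply/measurable_EFinP; apply: measurable_funM => //; exact: measurable_indic.
rewrite -lee_fin fineK ?fin_num_measure// -sumEFin.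
(* Every probability becomes the integral of an indicator, so a pointwise inequality suffices. *)
have -> : P B = (\int[P]_w (\1_B w)%:E)%E by rewrite integral_indic// setIT.
under eq_bigr => i _.
  rewrite EFinM fineK ?fin_num_measure//.
  rewrite (_ : P (A i) = \int[P]_w (\1_(A i) w)%:E)%E; last first.
    by rewrite integral_indic// setIT.
  rewrite -ge0_integralZl_EFin//; last first.
    by apply/measurable_EFinP; exact: measurable_indic.
  over.
rewrite -ge0_integral_sum//; last first.
  by move=> i w _; rewrite mule_ge0// lee_fin.
apply: ge0_le_integral => //.
- by apply/measurable_EFinP; exact: measurable_indic.
- exact: emeasurable_sum.
move=> w _; under eq_bigr do rewrite -EFinM.
rewrite sumEFin lee_fin indicE; case: (asboolP (B w)) => [Bw|].
  by rewrite mem_set//; exact: cB.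
move=> nBw; rewrite memNset//= sumr_ge0// => i _; exact: mulr_ge0.
Qed.

Section multi_split_bound.
Context d (T : measurableType d) (R : realType) (P : probability T R).
Variables (J : nat) (pv : 'I_J -> T -> R).
Hypothesis mpv : forall j, measurable_fun setT (pv j).

Lemma card_le_sum_indic (x : R) (w : T) :
  #|[set j | (pv j w <= x)%R]%SET|%:R =
  \sum_j \1_[set w | pv j w <= x] w :> R.
Proof.
rewrite -sum1_card natr_sum big_mkcond/=; apply: eq_bigr => j _.
rewrite inE indicE; case: ifPn => [pjx|/negP pjx]; first by rewrite mem_set.
by rewrite memNset.
Qed.

Lemma measurable_exists_card_le (D : set nat) (x : nat -> R) :
  measurable [set w | exists2 k, D k &
    (k <= #|[set j | (pv j w <= x k)%R]%SET|)%N].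
Proof.
have -> : [set w | exists2 k, D k & (k <= #|[set j | (pv j w <= x k)%R]%SET|)%N] =
    \bigcup_(k in D) [set w | - \sum_j \1_[set w | pv j w <= x k] w <= - k%:R :> R].
  apply/seteqP; split=> w [k Dk] kN; exists k => //; move: kN;
    by rewrite /= lerN2 -card_le_sum_indic ler_nat.
apply: bigcup_measurable => k _; apply: measurable_le_cst.
apply: measurable_funN; apply: measurable_sum => j.
by apply: measurable_indic; exact: measurable_le_cst.
Qed.

Lemma multi_split_bound (g a e : R) :
  (0 < J)%N -> 0 < g < 1 -> 0 < a ->
  (forall j k, (0 < k <= J)%N ->
    fine (P [set w | pv j w <= a * (k%:R / J%:R)]) <= a * (k%:R / J%:R) + e) ->
  0 <= e ->
  fine (P [set w | exists2 k, (k <= J)%N /\ g * J%:R < k%:R &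
    (k <= #|[set j | (pv j w <= a * (k%:R / J%:R))%R]%SET|)%N]) <=
  a * (1 - ln g) + J%:R * e.
Proof.
move=> J0 /andP[g0 g1] a0 pe e0.
have J0R : 0 < J%:R :> R by rewrite ltr0n.
(* The least integer strictly above [g J]. *)
pose k0 := (Num.truncn (g * J%:R)).+1.
have k0P k : (g * J%:R < k%:R) = (k0 <= k)%N.
  by rewrite /k0 truncn_lt_nat// mulr_ge0// ltW.
have k0J : (0 < k0 <= J)%N by rewrite /= -k0P gtr_pMl.
have k0R : 0 < k0%:R :> R by rewrite ltr0n.
pose s := [seq (j, k) | j <- index_enum 'I_J, k <- index_iota k0 J.+1].
apply: (@le_trans _ _ (\sum_(i <- s) layer_weight J i.2 *
    fine (P [set w | pv i.1 w <= a * (i.2%:R / J%:R)]))).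
  apply: weighted_markov.
  - exact: (measurable_exists_card_le [set k | (k <= J)%N /\ g * J%:R < k%:R]).
  - by move=> i; exact: measurable_le_cst.
  - by move=> i; exact: layer_weight_ge0.
  move=> w [k [kJ]]; rewrite k0P => k0k kN.
  (* Summing over [j] first turns the indicators into counts, which grow with [k] because the
     thresholds do. *)
  rewrite big_allpairs/= exchange_big/=.
  under eq_bigr do rewrite -mulr_sumr -card_le_sum_indic.
  apply: layer_weight_count kN => // [k' l kl].
  apply: subset_leq_card; apply/fintype.subsetP => j; rewrite !inE => /le_trans; apply.
  by rewrite ler_pM2l// ler_pM2r ?invr_gt0// ler_nat.
rewrite big_allpairs/=.
apply: (@le_trans _ _ (\sum_(j < J) \sum_(k0 <= k < J.+1)
    layer_weight J k * (a * (k%:R / J%:R) + e))).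
  apply: ler_sum => j _; apply: ler_sum_nat => k /andP[k0k kJ].
  by rewrite ler_wpM2l ?layer_weight_ge0// pe// (leq_trans _ k0k).
rewrite sumr_const card_ord -[leLHS]mulr_natl.
under eq_bigr => k _.
  rewrite mulrDr (_ : _ * (a * _) = a / J%:R * (layer_weight J k * k%:R)); last first.
    by field; rewrite lt0r_neq0.
  over.
rewrite big_split/= -mulr_sumr -mulr_suml sum_layer_weight//.
(* The error [e] carries, for each [j], total weight [1/k0 <= 1]. *)
rewrite [leLHS]mulrDr lerD//; last first.
  by rewrite ler_pM2l// ler_piMl// invf_le1// ler1n.
rewrite mulrA (mulrC J%:R) divfK ?lt0r_neq0// ler_pM2l//.
apply: (le_trans (sum_layer_weight_mul _ k0J)).
(* What remains is [J/k0 <= 1/g], which follows from [k0 > g J]. *)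
rewrite lerD2l -lnV ?posrE// ler_ln ?posrE ?invr_gt0 ?divr_gt0//.
rewrite ler_pdivrMr// -ler_pdivrMl ?invr_gt0// invrK.
by rewrite ltW// k0P.
Qed.

End multi_split_bound.

(** * Passage to the limit superior and conclusion *)

Lemma limn_esup_le_near (R : realType) (u : nat -> \bar R) (c : \bar R) :
  (\forall n \near \oo, (u n <= c)%E) -> (limn_esup u <= c)%E.
Proof.
move=> uc; rewrite /limn_esup limf_esupE; apply: (@le_trans _ _
  (ereal_sup (u @` [set n | (u n <= c)%E]))).
  by apply: ereal_inf_lbound; exists [set n | (u n <= c)%E].
by apply: ge_ereal_sup => _ [n /= un <-].
Qed.

Theorem proposition6 (R : realType)
  (d : nat -> measure_display) (T : forall n, measurableType (d n))
  (P : forall n, probability (T n) R)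
  (alpha gmin : R) (J : nat)
  (p m r nS nT : nat -> nat) (delta F : nat -> R)
  (X : forall n, T n -> 'M[R]_(n, p n))
  (Y E : forall n, T n -> 'M[R]_(n, m n))
  (B : forall n, 'M[R]_(p n, m n)) (Sigma : forall n, 'M[R]_(m n))
  (C : forall n, 'M[R]_(r n, p n))
  (S : forall n, 'I_J -> T n -> {set 'I_n})
  (M : forall n, 'I_J -> T n -> {set 'I_(p n)}) :
  0 < alpha < 1 -> 0 < gmin < 1 -> (0 < J)%N ->
  (* dimensions, sample sizes and tuning parameters *)
  (\forall n \near \oo,
    [/\ (n < p n)%N, (m n < n)%N, (nS n + nT n = n)%N,
        0 < delta n /\ 0 < F n
      & (Num.truncn (delta n * (p n)%:R) + m n < nT n)%N]) ->
  (* the regression model and the random splits *)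
  (forall n w, Y n w = X n w *m B n + E n w) ->
  (\forall n \near \oo, split_data (P n) (nS n) (Sigma n) (X n) (E n) (S n)) ->
  (* screening *)
  (\forall n \near \oo, forall j,
    random_element setT (M n j) /\
    forall w, top_canonical (Num.truncn (delta n * (p n)%:R))
      (rows_in (X n w) (S n j w)) (rows_in (Y n w) (S n j w)) (M n j w)) ->
  (* asymptotic validity of the p-values *)
  (forall j, cvg_stdnormal_given P
    (fun n => [set w | active_set (B n) \subset M n j w])
    (fun n w => test_stat (X n w) (Y n w) (C n) (F n) (S n j w) (M n j w))) ->
  (* the null hypothesis *)
  (forall n, C n *m B n = 0) ->
  (* sure screening *)
  (forall j, exists c0 iota : R, [/\ 0 < c0, iota < 1
    & (fun n : nat =>
         1 - fine (P n [set w | active_set (B n) \subset M n j w]) : R^o)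
      =O_\oo
      (fun n : nat => expR (- (c0 * n%:R `^ (1 - iota) / ln n%:R)) : R^o)]) ->
  (limn_esup (fun n => P n
    [set w | adjusted_pvalue
       (fun j => 1 - Phi (test_stat (X n w) (Y n w) (C n) (F n)
                            (S n j w) (M n j w))) gmin <= alpha]%R)
   <= alpha%:E)%E.
Proof.
move=> a01 g01 J0 _ _ _ scr valid _ sure.
have /andP[a0 a1] := a01; have /andP[g0 g1] := g01.
have lng : ln gmin < 0 by rewrite ln_lt0.
have L1 : 1 < 1 - ln gmin by rewrite ltrDl oppr_gt0.
have L0 : 0 < 1 - ln gmin := lt_trans ltr01 L1.
pose a := alpha / (1 - ln gmin).
have aL : a * (1 - ln gmin) = alpha by rewrite /a divfK ?lt0r_neq0.
have a_gt0 : 0 < a by rewrite divr_gt0.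
have a_lt1 : a < 1 by rewrite ltr_pdivrMr// mul1r (lt_trans a1).
have J0R : 0 < J%:R :> R by rewrite ltr0n.
pose Z n (j : 'I_J) w :=
  test_stat (X n w) (Y n w) (C n) (F n) (S n j w) (M n j w).
pose A n (j : 'I_J) := [set w | active_set (B n) \subset M n j w].
have mA : \forall n \near \oo, forall j, measurable (A n j).
  apply: filterS scr => n scrn j; have [mM _] := scrn j.
  apply: mM; exists [set K : {set 'I_(p n)} | active_set (B n) \subset K] => //.
  by rewrite setTI.
have mZ : \forall n \near \oo, forall j, measurable_fun setT (Z n j).
  by apply: filter_forall => j; have [] := valid j.
apply/lee_addgt0Pr => e e0.
(* The final bound carries the error [J e']. *)
pose e' := e / J%:R.
have e'0 : 0 < e' by rewrite divr_gt0.
(* The finitely many pairs of a split and a threshold share one range of large [n]; the successor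
   makes the thresholds run over 1 to [J]. *)
have pe : \forall n \near \oo, forall (jk : 'I_J * 'I_J),
    fine (P n [set w | 1 - Phi (Z n jk.1 w) <= a * (jk.2.+1%:R / J%:R)]) <=
    a * (jk.2.+1%:R / J%:R) + e'.
  apply: filter_forall => -[j k] /=.
  have [c0 [iota [c00 i1 uO]]] := sure j.
  apply: (pvalue_near_le _ (valid j) (sure_screening_cvg c00 i1 uO)) => //.
    by apply: filterS mA => n; apply.
  have k1 : 0 < k.+1%:R / J%:R :> R by rewrite divr_gt0.
  rewrite mulr_gt0//=; apply: le_lt_trans a_lt1.
  by rewrite ler_piMr ?(ltW a_gt0)// ler_pdivrMr// mul1r ler_nat.
apply: limn_esup_le_near; near=> n.
have mZn : forall j, measurable_fun setT (Z n j) by near: n.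
have pen : forall jk : 'I_J * 'I_J,
    fine (P n [set w | 1 - Phi (Z n jk.1 w) <= a * (jk.2.+1%:R / J%:R)]) <=
    a * (jk.2.+1%:R / J%:R) + e' by near: n.
have mp j : measurable_fun setT (fun w => 1 - Phi (Z n j w)).
  exact: measurable_pvalue.
have -> : [set w | adjusted_pvalue (fun j => 1 - Phi (Z n j w)) gmin <= alpha] =
    [set w | exists2 k, (k <= J)%N /\ gmin * J%:R < k%:R &
      (k <= #|[set j | (1 - Phi (Z n j w) <= a * (k%:R / J%:R))%R]%SET|)%N].
  apply/seteqP; split=> w /=.
    rewrite adjusted_pvalue_leP//; first by case=> k [kJ gk kN]; exists k.
    by move=> j; rewrite subr_ge0 Phi_le1 lerBlDr lerDl Phi_ge0.
  case=> k [kJ gk] kN; apply/adjusted_pvalue_leP => //; last by exists k.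
  by move=> j; rewrite subr_ge0 Phi_le1 lerBlDr lerDl Phi_ge0.
rewrite -[leLHS]fineK; last first.
  apply: fin_num_measure.
  exact: (measurable_exists_card_le mp [set k | (k <= J)%N /\ gmin * J%:R < k%:R]).
rewrite -EFinD lee_fin.
have <- : a * (1 - ln gmin) + J%:R * e' = alpha + e.
  by rewrite aL /e' mulrC divfK ?lt0r_neq0.
apply: multi_split_bound => //; last exact: ltW.
move=> j [//|k] /andP[_ kJ]; exact: (pen (j, Ordinal kJ)).
Unshelve. all: by end_near. Qed.
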